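(* Let $n$ and $m$ be positive integers. If every connected link projection with $n$, $n+1$ or $n+2$ crossings has $m$ or more independent regions, then $d(P) \geq m-1$ holds for every reduced knot projection $P$ with $n$ or more crossings, where $d(P)$ is the warping degree of $P$.
   Context: A link projection is the image on the sphere $S^2$ of a generic immersion of finitely many circles whose only singularities are finitely many transversal double points, called crossings; it is a knot projection if there is exactly one circle. It is connected if it is connected as a subset of $S^2$. A knot diagram is a knot projection with over/under information at every crossing. Knot projections and knot diagrams are assumed to have at least one crossing. The regions of a projection are the connected components of its complement in $S^2$. A crossing is reducible if some single region meets it in two opposite corners; a projection is reduced if it has no reducible crossing. Regions are independent if they share no crossings, i.e. no crossing lies on the boundary of two distinct ones among them; ''having $m$ or more independent regions'' means that there exists a set of at least $m$ regions which are independent. Warping degree: For an oriented knot diagram $D$ with a base point $b$ on $D$ that is not a crossing, a warping crossing point of $D_b$ is a crossing which is met first as an under-crossing when traveling along $D$ from $b$ following the orientation; $d(D_b)$ is the number of warping crossing points of $D_b$. The warping degree $d(D)$ of $D$ is the minimum of $d(D_b)$ over all base points $b$. A knot diagram is alternating if over-crossings and under-crossings are met alternately when traveling along it. The warping degree $d(P)$ of an (unoriented) knot projection $P$ is the minimum of $d(D)$ over all oriented alternating diagrams $D$ obtained from $P$ by giving an orientation and crossing information. *)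

(* Defs.v *)
From mathcomp Require Import all_boot all_fingroup.

Set Implicit Arguments.
Unset Strict Implicit.
Unset Printing Implicit Defensive.

Local Open Scope group_scope.

(* A connected link projection with at least one crossing, up to homeomorphism
   of the sphere: the image is a connected 4-valent graph drawn on S^2, whose
   vertices are the crossings, and is encoded by its rotation system.

   A dart is an end of an edge, i.e. a pair of a crossing and one of the four
   branches leaving it, pointing away from the crossing.  [opp x] is the other
   end of the edge of [x]; [rot x] is the next dart counterclockwise around the
   crossing of [x], so that the curve passes straight through that crossing
   from [rot (rot x)] to [x].  The dart [x] also names the corner of the
   crossing that lies between [x] and [rot x].

   [face] walks around a region keeping it on the left: from the corner to the
   left of [x], follow the edge to its other end and turn left.  As the graph is
   connected, the regions are discs and correspond to the orbits of [face].
   Since it has no crossing-free circle, the vertices, edges and regions are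
   exactly the orbits of [rot], [opp] and [face], and the closed surface carrying
   the drawing is S^2 if and only if V - E + F = 2.  This equation also rules
   out the empty projection. *)
Definition face_perm (D : finType) (opp rot : {perm D}) : {perm D} :=
  opp * rot^-1.

Record connected_projection := ConnectedProjection {
  dart : finType;
  opp : {perm dart};
  rot : {perm dart};
  oppK : involutive opp;
  opp_neq : forall x : dart, opp x != x;
  rot_order4 : forall x : dart, #|porbit rot x| = 4;
  dart_connected : forall x y : dart,
    connect [rel u v | (v == opp u) || (v == rot u)] x y;
  euler_sphere :
    #|porbits rot| + #|porbits (face_perm opp rot)| = #|porbits opp| + 2
}.

Section Projection.

Variable P : connected_projection.

Definition face : {perm dart P} := face_perm (opp P) (rot P).

Definition crossings : {set {set dart P}} := porbits (rot P).

(* A region is the set of its corners. *)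
Definition regions : {set {set dart P}} := porbits face.

(* The crossing [c] lies on the boundary of the region [r]. *)
Definition incident (c r : {set dart P}) : bool := c :&: r != set0.

Definition independent (S : {set {set dart P}}) : Prop :=
  forall r1 r2 : {set dart P}, r1 \in S -> r2 \in S -> r1 != r2 ->
  forall c : {set dart P}, c \in crossings -> ~~ (incident c r1 && incident c r2).

Definition has_independent_regions (m : nat) : Prop :=
  exists S : {set {set dart P}},
    [/\ S \subset regions, independent S & m <= #|S|].

Definition reducible (c : {set dart P}) : Prop :=
  exists2 r : {set dart P}, r \in regions &
  exists2 x : dart P, x \in c & (x \in r) && (rot P (rot P x) \in r).

Definition reduced : Prop :=
  forall c : {set dart P}, c \in crossings -> ~ reducible c.

(* Go along the edge of [x], then straight through the crossing at its end. *)
Definition travel : {perm dart P} := opp P * rot P * rot P.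

(* A circle of the projection is a closed walk going straight at crossings.  It
   is traced by two orbits of [travel], one for each direction, exchanged by
   [opp]; there is exactly one circle when any such walk covers all edges. *)
Definition is_knot : Prop :=
  forall x y : dart P, (y \in porbit travel x) || (opp P y \in porbit travel x).

(* [over x] means that the branch through [x] is the over-branch. *)
Definition crossing_info (over : {ffun dart P -> bool}) : bool :=
  [forall x, (over (rot P (rot P x)) == over x) && (over (rot P x) == ~~ over x)].

Definition alternating (over : {ffun dart P -> bool}) : bool :=
  [forall x, over (travel x) == ~~ over x].

(* An orientation of a knot projection is the set of darts pointing forward. *)
Definition orientations : {set {set dart P}} := porbits travel.

(* A base point is a point inside an edge, given by the forward dart [b] of that
   edge.  The successive passages through crossings met from there are recorded
   by the darts through which the crossings are left; each crossing of a knot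
   projection occurs twice. *)
Definition passages (b : dart P) : seq (dart P) :=
  traject travel (travel b) #|porbit travel b|.

Definition first_passage (b : dart P) (c : {set dart P}) : dart P :=
  nth b (passages b) (find (mem c) (passages b)).

Definition warping_crossings (over : {ffun dart P -> bool}) (b : dart P) :
    {set {set dart P}} :=
  [set c in crossings | ~~ over (first_passage b c)].

(* In the minima below the neutral element #|crossings| is an upper bound of all
   the values, hence does not affect a minimum over a nonempty family. *)
Definition diagram_warping_degree (over : {ffun dart P -> bool})
    (o : {set dart P}) : nat :=
  \big[minn/#|crossings|]_(b in o) #|warping_crossings over b|.

Definition warping_degree : nat :=
  \big[minn/#|crossings|]_(o in orientations)
    \big[minn/#|crossings|]_(over : {ffun dart P -> bool} |
                             crossing_info over && alternating over)
      diagram_warping_degree over o.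

End Projection.

(* Main.v *)
(* Two observations give the theorem.

   First, in a reduced alternating diagram every region whose boundary avoids the
   base edge has a warping crossing: if each of its crossings were first met from
   above, then, as every edge leads from an over- to an under-passage, the times of
   first over-passage would be monotone around the region, hence constant. Among
   independent regions at most one touches the base edge, and warping crossings of
   distinct ones are distinct, so m independent regions force d(P) >= m - 1.

   Second, a projection with more than n + 2 crossings reduces to one with one to
   three crossings less whose independent regions lift back. A reducible crossing
   is smoothed without disconnecting the projection. If there is none, Euler's
   formula provides a region with two or three sides, all of whose crossings are
   smoothed: the region merges with its neighbours across its sides, while each
   region opposite to one of its corners becomes adjacent to the merged one. *)

Require Import Defs.
From mathcomp Require Import all_boot all_fingroup.
From mathcomp Require Import zify.

Set Implicit Arguments.
Unset Strict Implicit.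
Unset Printing Implicit Defensive.

Local Open Scope group_scope.

(** * Orbits of permutations *)

Section PermutationOrbits.

Variable T : finType.
Implicit Types (s : {perm T}) (x y z : T).

Lemma porbit_eqP s x y : reflect (porbit s x = porbit s y) (x \in porbit s y).
Proof. by rewrite -eq_porbit_mem; apply: eqP. Qed.

Lemma porbit_step s x : porbit s (s x) = porbit s x.
Proof. by have := porbit_perm s 1 x; rewrite expg1. Qed.

Lemma porbit_fun_eq (I : Type) s (g : T -> I) x y :
  (forall z, g (s z) = g z) -> porbit s x = porbit s y -> g x = g y.
Proof.
move=> gs /porbit_eqP/porbitP[n ->].
by elim: n => [|n IHn]; rewrite ?expg0 ?perm1 // expgSr permM gs.
Qed.

(** A quantity that never grows along a cycle cannot drop either, since the walk returns to its
    starting point. *)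
Lemma porbit_homo_const s (R : {set T}) (h : T -> nat) x y :
    (forall z, z \in R -> h (s z) <= h z) -> R = porbit s x ->
  y \in R -> h (s y) = h y.
Proof.
move=> hs defR Ry.
have closedR z : z \in R -> s z \in R.
  by rewrite defR -!eq_porbit_mem porbit_step.
have iter_le n z : z \in R -> ((s ^+ n) z \in R) && (h ((s ^+ n) z) <= h z).
  move=> Rz; elim: n => [|n /andP[Rn le_n]]; first by rewrite expg0 perm1 Rz /=.
  by rewrite expgSr permM closedR //= (leq_trans (hs _ Rn)).
have: y \in porbit s (s y) by apply/porbit_eqP; rewrite porbit_step.
case/porbitP=> n def_y; apply/eqP; rewrite eqn_leq hs //=.
by have /andP[_] := iter_le n _ (closedR _ Ry); rewrite -def_y.
Qed.

Lemma porbit_morph (U : finType) (s' : {perm U}) s (i : U -> T) u :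
  (forall v, i (s' v) = s (i v)) -> i @: porbit s' u = porbit s (i u).
Proof.
move=> is'; have iX n v : i ((s' ^+ n) v) = (s ^+ n) (i v).
  by elim: n => [|n IHn]; rewrite ?expg0 ?perm1 // !expgSr !permM is' IHn.
apply/setP=> y; apply/imsetP/porbitP => [[v /porbitP[n ->] ->] | [n ->]].
  by exists n; rewrite iX.
by exists ((s' ^+ n) u); rewrite ?mem_porbit ?iX.
Qed.

Lemma porbits_fun_card (U : finType) s (g : T -> U) :
    (forall x y, porbit s x = porbit s y <-> g x = g y) ->
  #|porbits s| = #|g @: T|.
Proof.
move=> sg; have le_im (U1 U2 : finType) (g1 : T -> U1) (g2 : T -> U2) :
    (forall x y, g2 x = g2 y -> g1 x = g1 y) -> #|g1 @: T| <= #|g2 @: T|.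
  move=> g21; case: (pickP T) => [x0 _ | T0]; last first.
    rewrite (_ : g1 @: T = set0) ?cards0 //.
    by apply/setP=> u; rewrite inE; apply/negP=> /imsetP[x]; have := T0 x; rewrite inE.
  pose k v := g1 (odflt x0 [pick x | g2 x == v]).
  apply: leq_trans (leq_imset_card k _); apply/subset_leq_card/subsetP=> _ /imsetP[x _ ->].
  apply/imsetP; exists (g2 x); rewrite ?imset_f // /k.
  case: pickP => [y /eqP/= g2y | /(_ x)]; last by rewrite /= eqxx.
  exact/g21/esym.
by apply/eqP; rewrite eqn_leq !le_im // => x y /sg.
Qed.

Lemma partition_porbits s : partition (porbits s) [set: T].
Proof.
apply/and3P; split.
- apply/eqP/setP=> x; rewrite inE; apply/bigcupP.
  by exists (porbit s x); rewrite ?imset_f ?porbit_id.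
- apply/trivIsetP=> _ _ /imsetP[x _ ->] /imsetP[y _ ->]; apply: contraR.
  case/pred0Pn=> z /= /andP[/porbit_eqP zx /porbit_eqP zy].
  by rewrite -zx zy.
- by apply/imsetP=> -[x _ s0]; have := porbit_id s x; rewrite -s0 inE.
Qed.

Lemma card_porbits_uniform s k :
  (forall x, #|porbit s x| = k) -> #|T| = (k * #|porbits s|)%N.
Proof.
move=> card_k; rewrite -cardsT mulnC.
apply: card_uniform_partition (partition_porbits s) => _ /imsetP[x _ ->].
exact: card_k.
Qed.

Lemma card_porbits_leq s k :
  (forall x, k <= #|porbit s x|) -> k * #|porbits s| <= #|T|.
Proof.
move=> card_k; rewrite -cardsT (card_partition (partition_porbits s)) mulnC -sum_nat_const.
by apply: leq_sum => _ /imsetP[x _ ->].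
Qed.

(** A transposition of points on two distinct cycles splices these into one. The orbits themselves,
    not only their number, are needed to identify the regions of a smoothing. *)
Lemma porbit_tperm_merge s a b x y : porbit s a <> porbit s b ->
  porbit (tperm a b * s) x = porbit (tperm a b * s) y <->
    porbit s x = porbit s y \/
    [\/ porbit s x = porbit s a | porbit s x = porbit s b] /\
    [\/ porbit s y = porbit s a | porbit s y = porbit s b].
Proof.
move=> ab; set s' := tperm a b * s.
(* The permutation [s'] sends [d] to [s c] and from there follows the [s]-cycle of [c] all the way
   to [c]. *)
have half c d : porbit s c <> porbit s d -> s' = tperm c d * s ->
    forall z, porbit s z = porbit s c -> porbit s' z = porbit s' d.
  move=> cd def_s' z; rewrite -(porbit_step s c) => /porbit_eqP/porbitP[n ->].
  elim: n => [|n IHn].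
    by rewrite expg0 perm1 -(porbit_step s' d) def_s' permM tpermR.
  rewrite expgSr permM; set u := (s ^+ n) (s c) in IHn *.
  have [->|ne_uc] := eqVneq u c.
    by rewrite -(porbit_step s' d) {3}def_s' permM tpermR.
  have ne_ud : d != u.
    by apply/eqP=> def_d; apply: cd; rewrite def_d porbit_perm porbit_step.
  by rewrite -IHn -(porbit_step s' u) {3}def_s' permM tpermD // eq_sym.
have to_b z : porbit s z = porbit s a -> porbit s' z = porbit s' b by apply: half.
have to_a z : porbit s z = porbit s b -> porbit s' z = porbit s' a.
  by apply: half; [exact: nesym | rewrite tpermC].
have eq_ab := to_b a erefl.
have ss' z : porbit s' (s z) = porbit s' z.
  have [->|ne_za] := eqVneq z a; first by rewrite to_b ?porbit_step.
  have [->|ne_zb] := eqVneq z b; first by rewrite to_a ?porbit_step.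
  by rewrite -(porbit_step s' z) {3}/s' permM tpermD // eq_sym.
split=> [|[|[]]]; last 2 first.
- exact: porbit_fun_eq.
- by do 2![case=> /[dup] => [/to_b-> _|/to_a-> _]]; rewrite ?eq_ab.
(* This invariant of [s'] identifies the two spliced orbits and no others. *)
pose g z := if z \in porbit s b then porbit s a else porbit s z.
have gs' z : g (s' z) = g z.
  have g_s u : g (s u) = g u by rewrite /g -!eq_porbit_mem porbit_step.
  rewrite permM g_s; case: tpermP => // ->; rewrite /g porbit_id.
    by case: ifP.
  by case: ifP.
move/(porbit_fun_eq gs'); rewrite /g.
by case: porbit_eqP => [-> | _]; case: porbit_eqP => [-> | _] => e;
  [left | right; split; [right | left] | right; split; [left | right] | left].
Qed.

End PermutationOrbits.

Lemma card_porbit_involution (T : finType) (s : {perm T}) x :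
  involutive s -> s x != x -> #|porbit s x| = 2.
Proof.
move=> sK ne_sx; rewrite (_ : porbit s x = [set x; s x]) ?cards2 1?eq_sym ?ne_sx //.
apply/setP=> y; rewrite !inE; apply/idP/orP => [/porbitP[n ->] | ].
  elim: n => [|n IHn]; first by rewrite expg0 perm1; left.
  by rewrite expgSr permM; case: IHn => /eqP->; [right | left; rewrite sK].
by case=> /eqP->; rewrite ?porbit_id // -eq_porbit_mem porbit_step.
Qed.

Local Notation r := (Defs.rot _).
Local Notation o := (opp _).
Local Notation f := (face _).
Local Notation F := (porbit f).

(** * Darts, corners and the number of regions *)

Section Darts.

Variable P : connected_projection.
Implicit Types x y z : dart P.

Lemma rot4 x : r (r (r (r x))) = x.
Proof. by have := iter_porbit r x; rewrite rot_order4. Qed.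

Lemma rotV x : r^-1 x = r (r (r x)).
Proof. by apply: (@perm_inj _ (Defs.rot P)); rewrite permKV rot4. Qed.

Lemma mem_crossing x y :
  (y \in porbit r x) = (y \in [:: x; r x; r (r x); r (r (r x))]).
Proof. by rewrite porbit_traject rot_order4. Qed.

Lemma uniq_crossing x : uniq [:: x; r x; r (r x); r (r (r x))].
Proof. by have := uniq_traject_porbit r x; rewrite rot_order4. Qed.

Lemma faceE x : f x = r^-1 (o x).
Proof. by rewrite permM. Qed.

Lemma rot_face x : r (f x) = o x.
Proof. by rewrite faceE permKV. Qed.

Lemma face_opp x : f (o x) = r (r (r x)).
Proof. by rewrite faceE oppK rotV. Qed.

Lemma face_step x : F (f x) = F x.
Proof. exact: porbit_step. Qed.

Lemma face_oppE x : F (o x) = F (r (r (r x))).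
Proof. by rewrite -face_opp face_step. Qed.

Lemma card_dart_crossings : #|dart P| = (4 * #|crossings P|)%N.
Proof. exact/card_porbits_uniform/rot_order4. Qed.

(** V crossings have 4V darts, hence 2V edges, and Euler's formula leaves V + 2 regions. *)
Lemma card_regions : #|regions P| = #|crossings P| + 2.
Proof.
have E : #|crossings P| + #|regions P| = #|porbits (opp P)| + 2.
  exact: euler_sphere.
have V := card_dart_crossings.
have : #|dart P| = (2 * #|porbits (opp P)|)%N.
  apply: card_porbits_uniform => x; apply: card_porbit_involution.
    exact: oppK.
  exact: opp_neq.
by lia.
Qed.

Lemma dart_ind (K : pred (dart P)) x :
  (forall y, K y -> K (o y)) -> (forall y, K y -> K (r y)) -> K x ->
  forall y, K y.
Proof.
move=> Ko Kr Kx y; case/connectP: (dart_connected x y) => p.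
elim: p x Kx => [|z p IHp] x Kx /=; first by move=> _ ->.
by case/andP=> /orP[]/eqP-> pz def_y; apply: IHp pz def_y; auto.
Qed.

(* The crossing of [x] is to be smoothed by joining [x] with [r x] and [r (r x)]
   with [r (r (r x))], which merges the regions at the corners [r x] and
   [r (r (r x))]. *)
Definition smooth_merged x y := F y = F (r x) \/ F y = F (r (r (r x))).

Definition smooth_rel x y z :=
  F y = F z \/ smooth_merged x y /\ smooth_merged x z.

End Darts.

(* By [smooth_edge], each of the two new strands has the merged region on one side
   and the region of the corner [x], resp. [r (r x)], on the other side. *)
Record smoothing (P : connected_projection) (x : dart P) := Smoothing {
  smooth_proj : connected_projection;
  smooth_dart : dart smooth_proj -> dart P;
  smooth_inj : injective smooth_dart;
  smooth_codom : forall y, (y \in codom smooth_dart) = (y \notin porbit r x);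
  smooth_rot : forall q, smooth_dart (r q) = r (smooth_dart q);
  smooth_face : forall q q', porbit (face _) q = porbit (face _) q' <->
    smooth_rel x (smooth_dart q) (smooth_dart q');
  smooth_edge : forall y, y \in [:: x; r (r x)] ->
    exists q, smooth_rel x (smooth_dart q) y /\
              smooth_rel x (smooth_dart (opp _ q)) (r x);
  smooth_crossings : #|crossings smooth_proj|.+1 = #|crossings P|
}.

(** * Construction of the smoothing at a crossing *)

Section Smoothing.

Variables (P : connected_projection) (x : dart P).
Local Notation x1 := (r x).
Local Notation x2 := (r (r x)).
Local Notation x3 := (r (r (r x))).
Hypothesis crossings_gt1 : 1 < #|crossings P|.
Hypothesis merge_neq : F x1 <> F x3.
Implicit Types y z w : dart P.

Let B := porbit r x.

Let t : {perm dart P} := tperm x1 x3.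

(* On the crossing, [sg] exchanges the two ends that are joined. *)
Let sg y := t (r^-1 y).

Let B_cases y : y \in B -> [\/ y = x, y = x1, y = x2 | y = x3].
Proof.
rewrite /B mem_crossing !inE => /or4P[]/eqP->;
  by [constructor 1|constructor 2|constructor 3|constructor 4].
Qed.

Let xB : [/\ x \in B, x1 \in B, x2 \in B & x3 \in B].
Proof. by split; rewrite /B mem_crossing !inE eqxx ?orbT. Qed.

Let rB y : (r y \in B) = (y \in B).
Proof. by rewrite -!eq_porbit_mem porbit_step. Qed.

Let rVB y : (r^-1 y \in B) = (y \in B).
Proof. by rewrite -rB permKV. Qed.

Let xU : [/\ x1 != x, x2 != x, x3 != x & [/\ x2 != x1, x3 != x1 & x3 != x2]].
Proof.
have := uniq_crossing x; rewrite /= !inE !negb_or andbT.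
by case/and3P=> /and3P[? ? ?] /andP[? ?] ?; do !split; rewrite eq_sym.
Qed.

Let sgE : [/\ sg x = x1, sg x1 = x, sg x2 = x3 & sg x3 = x2].
Proof.
have [n1 n2 n3 [n4 n5 n6]] := xU.
by rewrite /sg !rotV !rot4 /t; split;
  rewrite ?tpermL ?tpermR ?tpermD // eq_sym.
Qed.

Let sgB y : y \in B -> sg y \in B.
Proof.
have [? ? ? ?] := xB; have [e0 e1 e2 e3] := sgE.
by case/B_cases=> ->; rewrite ?e0 ?e1 ?e2 ?e3.
Qed.

Let sgK y : y \in B -> sg (sg y) = y.
Proof.
have [e0 e1 e2 e3] := sgE.
by case/B_cases=> ->; rewrite ?(e0, e1, e2, e3).
Qed.

Let sg_neq y : y \in B -> sg y != y.
Proof.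
have [e0 e1 e2 e3] := sgE; have [n1 n2 n3 [n4 n5 n6]] := xU.
by case/B_cases=> ->; rewrite ?(e0, e1, e2, e3) 1?eq_sym // eq_sym.
Qed.

Let sg_cover w v z : w \in B -> v \in B -> z \in B -> v != w -> v != sg w ->
  z \in [:: w; sg w; v; sg v].
Proof.
have [e0 e1 e2 e3] := sgE.
case/B_cases=> ->; case/B_cases=> ->; rewrite ?(e0, e1, e2, e3) ?eqxx // => zB _ _;
by case/B_cases: zB => ->; rewrite !inE eqxx ?orbT.
Qed.

(** An edge between two joined ends would close up to a circle without crossings. By [face_oppE] it
    would also give [x1] and [x3] the same region, against [merge_neq]. *)
Let opp_sg y : y \in B -> o y != sg y.
Proof.
have [e0 e1 e2 e3] := sgE; have oE := @oppK P.
have ne1 : o x1 != x.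
  apply/eqP=> /(congr1 o); rewrite oE => ox; apply: merge_neq.
  by rewrite {1}ox face_oppE.
have ne3 : o x3 != x2.
  apply/eqP=> /(congr1 o); rewrite oE => ox; apply: merge_neq.
  by rewrite ox face_oppE rot4.
case/B_cases=> ->; rewrite ?(e0, e1, e2, e3) // inv_eq // eq_sym //.
Qed.

Let B_open : exists2 w, w \in B & o w \notin B.
Proof.
case: (pickP [pred w in B | o w \notin B]) => [w /andP[] | noB]; first by exists w.
have B_all y : y \in B.
  have [xB0 _ _ _] := xB.
  apply: (dart_ind (K := mem B) (x := x)) => //= z zB; last by rewrite rB.
  by apply: contraFT (noB z) => /= ->; rewrite andbT.
have cB : #|dart P| = 4.
  by rewrite -(rot_order4 x) -cardsT; apply: eq_card => y; rewrite inE B_all.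
by have := card_dart_crossings P; lia.
Qed.

(** If one loop edge at the crossing led directly into another, all four ends would belong to loops,
    against [B_open]. Hence a strand runs through at most one loop, and [pi] needs only two
    cases. *)
Let B_leave w : w \in B -> o w \in B -> o (sg (o w)) \notin B.
Proof.
move=> wB owB; apply/negP=> oswB; have [z zB /negP[]] := B_open.
have oE := @oppK P; have ne_o := @opp_neq P.
have e_osw : o (sg (o w)) = sg w.
  have := sg_cover wB owB oswB (ne_o w) (opp_sg wB).
  rewrite !inE (negbTE (ne_o _)) orbF => /or3P[]/eqP e //.
    by move/(congr1 o)/eqP: e; rewrite oE (negPf (sg_neq owB)).
  move/(congr1 o): e; rewrite !oE => /(congr1 sg)/eqP.
  by rewrite sgK // (negPf (opp_sg wB)).
have := sg_cover wB owB zB (ne_o w) (opp_sg wB).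
rewrite !inE => /or4P[]/eqP->; rewrite ?oE ?e_osw //; last exact: sgB.
by rewrite -e_osw oE sgB.
Qed.

(* The dart outside of the crossing reached by following the smoothed strand that
   enters it through [w]. *)
Let pi w := if o w \in B then o (sg (o w)) else o w.

(** The edge involution of the smoothing: an edge that ends at the removed crossing is continued
    along the strand starting there. *)
Let h y := if o y \in B then pi (sg (o y)) else o y.

Let piB w : w \in B -> pi w \notin B.
Proof. by move=> wB; rewrite /pi; case: ifPn => // /(B_leave wB). Qed.

Let hB y : y \notin B -> h y \notin B.
Proof. by rewrite /h; case: ifPn => // ? _; rewrite piB ?sgB. Qed.

Let h_pi w : w \in B -> h (pi w) = pi (sg w).
Proof.
move=> wB; have oE := @oppK P; rewrite [pi w]/pi; case: ifPn => owB; last first.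
  by rewrite /h oE wB.
rewrite /h oE sgB // sgK // {1}/pi oE wB /pi ifN //.
by have := B_leave owB; rewrite oE; apply.
Qed.

Let hK y : y \notin B -> h (h y) = y.
Proof.
move=> yB; have oE := @oppK P; rewrite [h y]/h; case: ifPn => oyB; last first.
  by rewrite /h oE (negPf yB).
by rewrite h_pi ?sgB // sgK // /pi oE (negPf yB).
Qed.

Let h_neq y : y \notin B -> h y != y.
Proof.
move=> yB; have oE := @oppK P; have ne_o := @opp_neq P.
rewrite /h; case: ifPn => // oyB; rewrite /pi; case: ifPn => osB.
  rewrite (inv_eq oE); apply: contraNneq (ne_o (sg (o y))) => e.
  by rewrite -{2}e sgK.
by rewrite (inv_eq oE) sg_neq.
Qed.

Let D : predArgType := {y : dart P | y \notin B}.

Let oQ0 (q : D) : D := Sub (h (val q)) (hB (valP q)).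

Let rBN y : y \notin B -> r y \notin B.
Proof. by rewrite rB. Qed.

Let rQ0 (q : D) : D := Sub (r (val q)) (rBN (valP q)).

Let oQ0K : involutive oQ0.
Proof. by move=> q; apply: val_inj; rewrite /= hK ?(valP q). Qed.

Let rQ0_inj : injective rQ0.
Proof. by move=> q q' /(congr1 val)/perm_inj/val_inj. Qed.

Let oQ : {perm D} := perm (inv_inj oQ0K).
Let rQ : {perm D} := perm rQ0_inj.

Let val_oQ q : val (oQ q) = h (val q).
Proof. by rewrite permE. Qed.

Let val_rQ q : val (rQ q) = r (val q).
Proof. by rewrite permE. Qed.

Let oQK : involutive oQ.
Proof. by move=> q; rewrite !permE. Qed.

Let oQ_neq q : oQ q != q.
Proof. by rewrite -val_eqE val_oQ h_neq // (valP q). Qed.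

Let rQ_order4 q : #|porbit rQ q| = 4.
Proof.
by rewrite -(card_imset _ val_inj) (porbit_morph (s := r) _ val_rQ) rot_order4.
Qed.

Let fQ : {perm D} := face_perm oQ rQ.

Let val_fQ q : val (fQ q) = r^-1 (h (val q)).
Proof. by apply: (@perm_inj _ (Defs.rot P)); rewrite -val_rQ permM !permKV val_oQ. Qed.

(* The regions of the smoothing are the orbits of [f'] restricted to the remaining
   darts, and [rho] is the first remaining dart of the [f']-walk. *)
Let f' : {perm dart P} := t * f.

Let tN y : y \notin B -> t y = y.
Proof.
have [_ xB1 _ xB3] := xB.
by move=> yB; rewrite /t tpermD //; apply: contraNneq yB => <-.
Qed.

Let tB y : y \in B -> t y \in B.
Proof. by have [_ xB1 _ xB3] := xB; rewrite /t; case: tpermP => // ->. Qed.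

Let rho y := if y \in B then r^-1 (pi (t y)) else y.

Let rhoB y : rho y \notin B.
Proof. by rewrite /rho; case: ifPn => // yB; rewrite rVB piB ?tB. Qed.

Let f'E y : f' y = r^-1 (o (t y)).
Proof. by rewrite permM faceE. Qed.

Let rho_fQ q : rho (f' (val q)) = val (fQ q).
Proof.
rewrite val_fQ f'E tN ?(valP q) // /rho rVB /h.
by case: ifP.
Qed.

Let rho_f' y : y \in B -> rho (f' y) = rho y.
Proof.
move=> yB; rewrite f'E /rho yB rVB; have tyB := tB yB.
case: ifPn => oB; last by rewrite /pi (negPf oB).
by rewrite -/(sg _) {1}/pi (negPf (B_leave tyB oB)) /pi oB.
Qed.

Let rho_orbit y : porbit f' (rho y) = porbit f' y.
Proof.
rewrite /rho; case: ifP => // yB; rewrite -(porbit_step f' y) f'E /pi.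
case: ifPn => // oB; rewrite -[RHS](porbit_step f') f'E //.
Qed.

Let fQ_orbit q q' :
  porbit fQ q = porbit fQ q' <-> porbit f' (val q) = porbit f' (val q').
Proof.
split.
  apply: (@porbit_fun_eq _ _ _ (fun u => porbit f' (val u))) => u.
  by rewrite -rho_fQ rho_orbit porbit_step.
pose g y := porbit fQ (Sub (rho y) (rhoB y)).
have gE u : g (val u) = porbit fQ u.
  by congr porbit; apply: val_inj; rewrite /= /rho (negPf (valP u)).
rewrite -!gE; apply: (@porbit_fun_eq _ _ _ g) => y; have [yB | yN] := boolP (y \in B).
  by congr porbit; apply: val_inj; rewrite /= rho_f'.
rewrite -[y]/(val (Sub y yN : D)) gE -porbit_step; congr porbit.
by apply: val_inj; rewrite -rho_fQ.
Qed.

Let card_D : (#|D| + 4 = #|dart P|)%N.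
Proof.
by rewrite card_sig -(rot_order4 x) addnC -(cardC (mem (porbit r x))).
Qed.

Let card_crossings : #|porbits rQ|.+1 = #|crossings P|.
Proof.
have VQ : #|D| = (4 * #|porbits rQ|)%N := card_porbits_uniform rQ_order4.
have V : #|dart P| = (4 * #|crossings P|)%N := card_dart_crossings P.
by have := card_D; lia.
Qed.

(** Every cycle of [f'] contains a dart of [D], namely a value of [rho], so only the splice loses a
    region. With one crossing and two edges less, Euler's equation persists. *)
Let card_fQ : #|porbits fQ|.+1 = #|regions P|.
Proof.
rewrite (porbits_fun_card (g := fun q => porbit f' (val q))); last first.
  exact: fQ_orbit.
rewrite (_ : [set _ | q : D] = porbits f'); last first.
  apply/setP=> R; apply/imsetP/imsetP => [[q _ ->] | [y _ ->]].
    by exists (val q).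
  by exists (Sub (rho y) (rhoB y)); rewrite //= rho_orbit.
have: #|porbits f'| + (x1 \notin F x3).*2 = #|regions P| + (x1 != x3).
  exact: porbits_mul_tperm.
have [_ _ _ [_ n5 _]] := xU; rewrite (eq_sym x1) n5.
by have -> : x1 \notin F x3; [apply/porbit_eqP | rewrite /=; lia].
Qed.

Let fQ_euler : #|porbits rQ| + #|porbits fQ| = #|porbits oQ| + 2.
Proof.
have VQ : #|D| = (4 * #|porbits rQ|)%N := card_porbits_uniform rQ_order4.
have EQ : #|D| = (2 * #|porbits oQ|)%N.
  exact: card_porbits_uniform (fun q => card_porbit_involution oQK (oQ_neq q)).
have FP : #|regions P| = #|crossings P| + 2 := card_regions P.
by have := card_crossings; have := card_fQ; lia.
Qed.

(* Otherwise the crossing of [x] would be a cut vertex, and walking along the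
   region of [x1] one could only leave its side through the corner of [x3]. *)
Let connected_across (K : pred (dart P)) :
    (forall y, K (o y) = K y) -> (forall y, y \notin B -> K (r y) = K y) ->
    K x = K x1 -> K x2 = K x3 -> K x1 = K x2.
Proof.
have wlog_K (L : pred (dart P)) :
    (forall y, L (o y) = L y) -> (forall y, y \notin B -> L (r y) = L y) ->
    L x = L x1 -> L x2 = L x3 -> L x1 -> L x2.
  move=> Lo Lr L01 L23 L1; apply: contraT => L2.
  have allL n : L ((f ^+ n) x1).
    elim: n => [|n IHn]; first by rewrite expg0 perm1.
    set z := (f ^+ n) x1 in IHn; have: L (r ((f ^+ n.+1) x1)).
      by rewrite expgSr permM rot_face Lo.
    set y := (f ^+ n.+1) x1.
    have ne3 : y <> x3.
      by move=> e; apply: merge_neq; rewrite -e porbit_perm.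
    have [/B_cases[]e|yN] := boolP (y \in B); rewrite ?e ?L01 //; last by rewrite Lr.
    by rewrite -L23 (negPf L2).
  (* The edge of [x2] has the region of [x1] on its other side, so the walk carries [L] over to
     [x2]. *)
  have: o x2 \in F x1.
    by apply/porbit_eqP; rewrite face_oppE rot4.
  by case/porbitP=> n e; have := allL n; rewrite -e Lo (negPf L2).
move=> Ko Kr K01 K23; apply/idP/idP; first exact: wlog_K.
apply: contraTT; apply: (wlog_K (predC K)) => [y|y yN||] /=;
  by [rewrite Ko | rewrite Kr | rewrite K01 | rewrite K23].
Qed.

Let Q_connected (u v : D) :
  connect [rel u v | (v == oQ u) || (v == rQ u)] u v.
Proof.
pose e : rel D := [rel u v | (v == oQ u) || (v == rQ u)]; pose A q := connect e u q.
have Ae q q' : e q q' -> A q -> A q'.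
  by move=> eqq' Aq; exact: connect_trans Aq (connect1 eqq').
have Ao q : A (oQ q) = A q.
  apply/idP/idP; first by apply: (Ae (oQ q) q); rewrite /e /= oQK eqxx.
  by apply: Ae; rewrite /e /= eqxx.
have Ar q : A (rQ q) = A q.
  have Ar1 q1 : A q1 -> A (rQ q1).
    by apply: Ae; rewrite /e /= eqxx orbT.
  apply/idP/idP => [Aq|]; last exact: Ar1.
  have <- : rQ (rQ (rQ (rQ q))) = q.
    by apply: val_inj; rewrite !val_rQ rot4.
  by do 3!apply: (Ar1).
have pB y : (if y \in B then pi y else y) \notin B.
  by case: ifPn => // /piB.
pose p y : D := Sub (if y \in B then pi y else y) (pB y).
(* Reachability from [u] is extended to the four removed darts by reading it off where their edges
   lead, so that the connectedness of [P] can be used. *)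
pose K y := A (p y).
have Ksg w : w \in B -> K (sg w) = K w.
  move=> wB; rewrite /= -[RHS]Ao; congr (A _); apply: val_inj.
  by rewrite val_oQ /= wB (sgB wB) h_pi.
have Ko y : K (o y) = K y.
  have oE := @oppK P; have [yB | yN] := boolP (y \in B).
    have [oyB | oyN] := boolP (o y \in B); last first.
      by congr (A _); apply: val_inj; rewrite /= yB (negPf oyN) /pi (negPf oyN).
    rewrite -Ksg //; congr (A _); apply: val_inj.
    by rewrite /= yB (sgB oyB) /pi oyB (negPf (B_leave yB oyB)).
  have [oyB | oyN] := boolP (o y \in B).
    by congr (A _); apply: val_inj; rewrite /= oyB (negPf yN) /pi oE (negPf yN).
  rewrite /= -[RHS]Ao; congr (A _); apply: val_inj.
  by rewrite val_oQ /= (negPf yN) (negPf oyN) /h (negPf oyN).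
have Kr y : y \notin B -> K (r y) = K y.
  move=> yN; rewrite /= -[RHS]Ar; congr (A _); apply: val_inj.
  by rewrite val_rQ /= (negPf yN) rB (negPf yN).
have [xB0 xB1 xB2 xB3] := xB; have [e0 e1 e2 e3] := sgE.
have K01 : K x = K x1 by rewrite -e0 Ksg.
have K23 : K x2 = K x3 by rewrite -e2 Ksg.
have K12 := connected_across Ko Kr K01 K23.
have pval q : p (val q) = q.
  by apply: val_inj; rewrite /= (negPf (valP q)).
suff allK y : K y by have := allK (val v); rewrite /K pval.
move: y; apply: (dart_ind (x := val u)) => [y|y|]; first by rewrite Ko.
  have [/B_cases[]->|yN] := boolP (y \in B); last by rewrite Kr.
  - by rewrite K01.
  - by rewrite K12.
  - by rewrite K23.
  - by rewrite rot4 K01 K12 K23.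
by rewrite /K pval; apply: connect0.
Qed.

Let Q := ConnectedProjection oQK oQ_neq rQ_order4 Q_connected fQ_euler.

Let f'_rel y z : porbit f' y = porbit f' z <-> smooth_rel x y z.
Proof. exact: porbit_tperm_merge. Qed.

Let pi_orbit w : w \in B -> porbit f' (pi w) = porbit f' (r^-1 w).
Proof.
move=> wB; have oE := @oppK P.
rewrite -(porbit_step f' (pi w)) f'E tN ?piB // /pi.
case: ifPn => owB; rewrite oE // -(porbit_step f') f'E.
by rewrite -/(sg (sg (o w))) sgK // oE.
Qed.

Lemma smoothing_exists : smoothing x.
Proof.
apply: (@Smoothing P x Q val) => //.
- exact: val_inj.
- move=> y; apply/codomP/idP => [[q ->] | yN]; first exact: (valP q).
  by exists (Sub y yN).
- by move=> q q'; rewrite -f'_rel; apply: fQ_orbit.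
(* The strand joining [w] with [sg w] becomes part of the edge with ends [pi w] and [pi (sg w)];
   [pi_orbit] gives its two sides. *)
have edge w : w \in B -> exists q : dart Q,
    porbit f' (val q) = porbit f' (r^-1 (sg w)) /\
    porbit f' (val (opp Q q)) = porbit f' (r^-1 w).
  move=> wB; exists (Sub (pi (sg w)) (piB (sgB wB))); split=> /=.
    by rewrite pi_orbit // sgB.
  by rewrite val_oQ /= h_pi ?sgB // sgK // pi_orbit.
have [xB0 xB1 xB2 xB3] := xB; have [e0 e1 e2 e3] := sgE.
move=> y; rewrite !inE => /pred2P[]->.
  have [q] := edge _ xB0; rewrite e0 permK rotV => -[q0 q1].
  exists q; rewrite -!f'_rel; split=> //; rewrite q1.
  by apply/f'_rel; right; split; [right | left].
have [q] := edge _ xB2; rewrite e2 !permK => -[q0 q1].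
by exists q; rewrite -!f'_rel.
Qed.

End Smoothing.

(** * Consequences of Euler's formula for regions and corners *)

Section Faces.

Variable P : connected_projection.
Implicit Types (x y z : dart P) (T : {set dart P}).

Lemma face_closed T x y :
  (forall z, z \in T -> f z \in T) -> x \in T -> F y = F x -> y \in T.
Proof.
move=> Tf Tx /porbit_eqP/porbitP[n ->].
by elim: n => [|n IHn]; rewrite ?expg0 ?perm1 // expgSr permM Tf.
Qed.

(** If all of the V + 2 regions had four or more sides, there would be more than 4V darts. *)
Lemma exists_small_face : exists t : dart P, #|F t| <= 3.
Proof.
case: (pickP [pred t : dart P | #|F t| <= 3]) => [t | big]; first by exists t.
have: 4 * #|regions P| <= #|dart P|.
  by apply: card_porbits_leq => t; rewrite ltnNge; have /= -> := big t.
have FP : #|regions P| = #|crossings P| + 2 := card_regions P.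
have V : #|dart P| = (4 * #|crossings P|)%N := card_dart_crossings P.
by lia.
Qed.

(** Otherwise the regions of [x] and [r x] would alternate around every crossing, leaving at most
    two regions where Euler's formula gives at least three. *)
Lemma exists_irreducible_corner x :
  exists y : dart P, F y <> F (r (r y)).
Proof.
case: (pickP [pred y : dart P | F y != F (r (r y))]) => [y /eqP | red]; first by exists y.
have rr (y : dart P) : F (r (r y)) = F y by have /= /negbFE/eqP-> := red y.
pose K y := (F y == F x) && (F (r y) == F (r x)) ||
            (F y == F (r x)) && (F (r y) == F x).
have Ko y : K y -> K (o y).
  have e1 : F (o y) = F (r y) by rewrite face_oppE rr.
  have e2 : F (r (o y)) = F y by rewrite -[o y]rot_face rr face_step.
  by rewrite /K e1 e2 => /orP[] /andP[-> ->]; rewrite ?orbT.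
have Kr y : K y -> K (r y).
  by rewrite /K rr => /orP[] /andP[-> ->]; rewrite ?orbT.
have allK : forall y, K y by apply: (dart_ind Ko Kr (x := x)); rewrite /K !eqxx.
have: #|regions P| <= #|[set F x; F (r x)]|.
  apply/subset_leq_card/subsetP=> _ /imsetP[y _ ->]; rewrite !inE.
  by have /orP[] := allK y => /andP[-> _]; rewrite ?orbT.
have FP : #|regions P| = #|crossings P| + 2 := card_regions P.
have: 0 < #|crossings P|.
  by apply/card_gt0P; exists (porbit r x); apply: imset_f.
by rewrite cards2; lia.
Qed.

End Faces.

(* A form of the Jordan curve theorem. Smoothing another crossing preserves a
   counterexample, and Euler's formula yields a crossing that is not one. *)
Lemma opposite_corners_separate (P : connected_projection) (x : dart P) :
  F x = F (r (r x)) ->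
  F (r x) <> F (r (r (r x))).
Proof.
have [n] := ubnP #|crossings P|; elim: n => // n IHn in P x * => leVn F02 F13.
have [y Fy] := exists_irreducible_corner x.
(* With this choice the merged corners [r w] and [r (r (r w))] are [y] and [r (r y)]. *)
pose w := r (r (r y)).
have rw : r w = y by rewrite /w rot4.
have xNw : x \notin porbit r w.
  rewrite -eq_porbit_mem 3!porbit_step eq_porbit_mem porbit_sym mem_crossing.
  apply/negP; rewrite !inE => /or4P[]/eqP e; apply: Fy; rewrite e ?rot4 //.
have V2 : 1 < #|crossings P|.
  apply/card_gt1P; exists (porbit r x), (porbit r w).
  by split; rewrite ?imset_f ?eq_porbit_mem.
have Fw : F (r w) <> F (r (r (r w))) by rewrite rw.
have [Q i _ codom_i ir iF _ VQ] := smoothing_exists V2 Fw.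
have /codomP[q xE] : x \in codom i by rewrite codom_i.
have VQn : #|crossings Q| < n by rewrite -ltnS VQ.
(* Smoothing never splits a region, so both coincidences at [x] persist in [Q]. *)
case: (IHn Q q VQn); apply/iF; rewrite !ir -xE; left => //.
Qed.

(* Each region is represented by one of its corners. *)
Definition independent_corners (P : connected_projection) (S : {set dart P}) :=
  forall y z u v, y \in S -> z \in S -> y != z ->
  F u = F y -> F v = F z -> porbit r u <> porbit r v.

(** * Independence and its lifting through a smoothing *)

Section IndependentCorners.

Variables (P : connected_projection) (S : {set dart P}).
Hypothesis indS : independent_corners S.

Lemma independent_corners_inj : {in S &, injective F}.
Proof.
move=> y z yS zS Fyz; apply/eqP; apply: contraT => ne_yz.
by case: (indS yS zS ne_yz erefl Fyz).
Qed.

(** Both sides of an edge meet the crossing at its end, so independent regions cannot lie on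
    different sides. *)
Lemma independent_corners_edge y z q :
  y \in S -> z \in S -> F q = F y -> F (opp P q) = F z -> y = z.
Proof.
move=> yS zS Fq Foq; apply/eqP; apply: contraT => ne_yz.
rewrite face_oppE in Foq; case: (indS yS zS ne_yz Fq Foq).
by rewrite !porbit_step.
Qed.

End IndependentCorners.

(* Regions that become independent only by losing the crossing of [x] would both
   meet it. They cannot both be merged; a merged one and the region of [x] or
   [r (r x)] still share a new strand; so only the regions of [x] and of [r (r x)]
   remain. *)
Lemma independent_corners_lift (P : connected_projection) (x : dart P)
    (s : smoothing x) (S : {set dart (smooth_proj s)}) :
    independent_corners S ->
    F x = F (r (r x)) \/
    (forall q, q \in S -> F (smooth_dart q) <> F x) ->
  independent_corners (smooth_dart (s := s) @: S).
Proof.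
case: s S => Q i inj_i codom_i ir iF edge VQ /= S indS Sx y z u v.
case/imsetP=> q1 S1 ->{y} /imsetP[q2 S2 ->{z}] ne_iq Fu Fv ruv.
have ne_q : q1 <> q2 by move=> e; rewrite e eqxx in ne_iq.
have not_rel : ~ smooth_rel x (i q1) (i q2).
  by move/iF/(independent_corners_inj indS S1 S2).
pose outer (y : dart P) := y \in [:: x; r (r x)].
have not_edge p1 p2 y : p1 \in S -> p2 \in S -> p1 <> p2 -> outer y ->
    F (i p1) = F y -> smooth_merged x (i p2) -> False.
  move=> Sp1 Sp2 ne_p out_y Fp1 Mp2; have [q [qy oqx]] := edge y out_y.
  apply: ne_p; apply: (independent_corners_edge indS (q := q)) => //; apply/iF.
    by case: qy; rewrite /smooth_rel /smooth_merged Fp1; auto.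
  right; split=> //; case: oqx => [e | []//]; by left.
have corner w q : w \in porbit r x -> F w = F (i q) ->
    (exists2 y, outer y & F (i q) = F y) \/ smooth_merged x (i q).
  rewrite mem_crossing !inE => /or4P[]/eqP-> /esym e.
  - by left; exists x; rewrite // /outer !inE eqxx.
  - by right; left.
  - by left; exists (r (r x)); rewrite // /outer !inE eqxx orbT.
  - by right; right.
have [uB | uN] := boolP (u \in porbit r x).
  have vB : v \in porbit r x by apply/porbit_eqP; rewrite -ruv; apply/porbit_eqP.
  have [[y out_y F1]|M1] := corner _ _ uB Fu; have [[z out_z F2]|M2] := corner _ _ vB Fv.
  - have ne12 : F (i q1) <> F (i q2).
      by move=> e; apply: not_rel; left.
    move: out_y out_z F1 F2 ne12; rewrite /outer !inE.
    move=> /pred2P[]-> /pred2P[]-> F1 F2 ne12.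
    + by rewrite F1 F2 in ne12.
    + by case: Sx => [e|/(_ _ S1)//]; rewrite F1 F2 e in ne12.
    + by case: Sx => [e|/(_ _ S2)//]; rewrite F1 F2 e in ne12.
    + by rewrite F1 F2 in ne12.
  - exact: not_edge F1 M2.
  - by apply: (not_edge q2 q1 z) => // /esym.
  by apply: not_rel; right.
have vN : v \notin porbit r x.
  by rewrite -eq_porbit_mem -ruv eq_porbit_mem.
(* A shared crossing that survives the smoothing contradicts independence in [Q]. *)
have /codomP[p1 uE] : u \in codom i by rewrite codom_i.
have /codomP[p2 vE] : v \in codom i by rewrite codom_i.
apply: (indS q1 q2 p1 p2) => //; first exact/eqP.
- by apply/iF; left; rewrite -uE.
- by apply/iF; left; rewrite -vE.
by apply: (imset_inj inj_i); rewrite !(porbit_morph _ ir) -uE -vE.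
Qed.

(* Here [T] is a small region whose corners are smoothed one after the other.
   Avoiding [T] is what lets independent corners lift through each smoothing. *)
Definition erasable (P : connected_projection) (T : {set dart P}) (k : nat) :=
  exists Q : connected_projection, #|crossings Q| + k = #|crossings P| /\
  forall S : {set dart Q}, independent_corners S ->
  exists S' : {set dart P},
    [/\ independent_corners S', #|S'| = #|S| & forall y, y \in S' -> y \notin T].

(** * Erasing reducible crossings and small regions *)

Lemma erase_reducible (P : connected_projection) (x : dart P) :
    1 < #|crossings P| -> F x = F (r (r x)) ->
  erasable (porbit r x) 1.
Proof.
(* The other two corners lie in distinct regions, which is what makes the smoothing connected. *)
move=> V2 F02; have F13 := opposite_corners_separate F02.
pose s := smoothing_exists V2 F13; exists (smooth_proj s); split.
  by rewrite addn1 smooth_crossings.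
move=> S indS; exists (smooth_dart (s := s) @: S); split.
- by apply: independent_corners_lift => //; left.
- exact/card_imset/smooth_inj.
by move=> _ /imsetP[q _ ->]; rewrite -(smooth_codom s) codom_f.
Qed.

(** The region outside a loop meets its crossing in the opposite corners [r t] and [r (r (r t))], so
    this crossing is reducible. *)
Lemma erase_monogon (P : connected_projection) (t : dart P) :
    1 < #|crossings P| -> f t = t -> erasable [set t] 1.
Proof.
move=> V2 ft; have ot : o t = r t by rewrite -rot_face ft.
have [|Q [VQ ext]] := @erase_reducible _ (r t) V2.
  by rewrite -face_oppE ot.
exists Q; split=> // S /ext[S' [indS' cardS' S'N]]; exists S'; split=> // y.
move/S'N; rewrite inE; apply: contraNneq => ->.
by rewrite -eq_porbit_mem porbit_step.
Qed.

(** Corners lifted so far avoid [T], which contains the region of [x]; this is the second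
    alternative in [independent_corners_lift]. *)
Lemma erase_corner (P : connected_projection) (x : dart P) (T : {set dart P}) k
    (s : smoothing x) :
    (forall y, F y = F x -> y \in T) ->
  erasable (smooth_dart (s := s) @^-1: T) k -> erasable T k.+1.
Proof.
move=> TFx [Q [VQ ext]]; exists Q; split.
  by rewrite addnS VQ smooth_crossings.
move=> S /ext[S' [indS' cardS' S'N]]; have S'T q : q \in S' -> smooth_dart q \notin T.
  by move/S'N; rewrite inE.
exists (smooth_dart (s := s) @: S'); split.
- apply: independent_corners_lift => //; right=> q /S'T qN e.
  by rewrite TFx in qN.
- by rewrite card_imset //; apply: smooth_inj.
by move=> _ /imsetP[q /S'T qN ->].
Qed.

(* Smoothing one corner of a bigon leaves a monogon. *)
Lemma erase_bigon (P : connected_projection) (t u : dart P) :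
    2 < #|crossings P| -> f t = u -> f u = t -> t != u -> u != r (r t) ->
    F (r t) <> F (r (r (r t))) ->
  erasable [set t; u] 2.
Proof.
move=> V3 ft fu ne_tu ne_u2 F13; have V2 := ltnW V3.
pose s := smoothing_exists V2 F13; apply: (@erase_corner _ t _ _ s).
  move=> y; apply: face_closed; last by rewrite !inE eqxx.
  by move=> z; rewrite !inE => /pred2P[]->; rewrite ?ft ?fu eqxx ?orbT.
have Tmem (y : dart P) : F y = F u -> y = t \/ y = u.
  move=> Fy; apply/pred2P; have: y \in [set t; u]; last by rewrite !inE.
  apply: face_closed Fy; last by rewrite !inE eqxx orbT.
  by move=> z; rewrite !inE => /pred2P[]->; rewrite ?ft ?fu eqxx ?orbT.
have := uniq_crossing t; rewrite /= !inE !negb_or .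
case/and4P=> /and3P[n01 _ n03] _ _ _.
have u_ne1 : u != r t.
  apply/eqP=> e; have := rot_face u; rewrite fu -e => e'.
  by have := opp_neq u; rewrite -e' eqxx.
have u_ne3 : u != r (r (r t)).
  apply/eqP=> e; have := rot_face t; rewrite ft e rot4 => e'.
  by have := opp_neq t; rewrite -e' eqxx.
have uN : u \notin porbit r t.
  by rewrite mem_crossing !inE !negb_or u_ne1 ne_u2 u_ne3 eq_sym ne_tu.
have /codomP[q uE] : u \in codom (smooth_dart (s := s)) by rewrite smooth_codom.
(* The bigon itself is not merged with anything, so [u] remains as its only corner. *)
have not_merged : ~ smooth_merged t u.
  by case=> /esym/Tmem[]/eqP; rewrite eq_sym
    ?(negPf n01) ?(negPf n03) ?(negPf u_ne1) ?(negPf u_ne3).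
have tN p : smooth_dart (s := s) p <> t.
  move=> e; have := smooth_codom s t; rewrite -{1}e codom_f.
  by rewrite porbit_id.
have -> : smooth_dart (s := s) @^-1: [set t; u] = [set q].
  apply/setP=> p; rewrite !inE uE (inj_eq (smooth_inj (s := s))).
  by case: eqP => // /tN.
apply: erase_monogon; first by have := smooth_crossings s; lia.
apply: (smooth_inj (s := s)); rewrite -uE.
have /(smooth_face (s := s)): porbit (face _) (face _ q) = porbit (face _) q.
  exact: face_step.
by rewrite -uE => -[/Tmem[/tN|]// | [_ /not_merged]].
Qed.

(* Smoothing one corner of a triangle leaves a bigon, whose two sides still bound
   different regions because the three sides did. *)
Lemma erase_trigon (P : connected_projection) (t u v : dart P) :
    3 < #|crossings P| -> f t = u -> f u = v -> f v = t -> uniq [:: t; u; v] ->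
    (forall y : dart P, F y <> F (r (r y))) ->
  erasable [set t; u; v] 3.
Proof.
move=> V4 ft fu fv /= /and3P[]; rewrite !inE negb_or => /andP[ne_tu ne_tv] ne_uv _ red.
have V2 : 1 < #|crossings P| by lia.
pose s := smoothing_exists V2 (red (r t)); apply: (@erase_corner _ t _ _ s).
  move=> y; apply: face_closed; last by rewrite !inE eqxx.
  by move=> z; rewrite !inE => /orP[/orP[]|]/eqP->; rewrite ?ft ?fu ?fv eqxx ?orbT.
have Ftu : F t = F u by rewrite -ft face_step.
have Fuv : F u = F v by rewrite -fu face_step.
have Tmem (y : dart P) : F y = F u -> [\/ y = t, y = u | y = v].
  move=> Fy; have: y \in [set t; u; v].
    apply: face_closed Fy; last by rewrite !inE eqxx !orbT.
    by move=> z; rewrite !inE => /orP[/orP[]|]/eqP->; rewrite ?ft ?fu ?fv eqxx ?orbT.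
  by rewrite !inE => /orP[/orP[]|]/eqP->; [constructor 1|constructor 2|constructor 3].
have ot : o t = r u by rewrite -ft rot_face.
have ou : o u = r v by rewrite -fu rot_face.
have ov : o v = r t by rewrite -fv rot_face.
have r_ne (z : dart P) : r z <> z.
  move=> e; have := uniq_crossing z; rewrite /= !inE e eqxx //.
have o_ne (z : dart P) : o z <> z by apply/eqP/opp_neq.
(* These inequalities place [u] and [v] at crossings other than that of [t], so both survive the
   first smoothing. *)
have u_ne1 : u <> r t by move=> e; apply: (r_ne v); rewrite -ou e -ov oppK.
have u_ne3 : u <> r (r (r t)) by move=> e; apply: (o_ne t); rewrite ot e rot4.
have v_ne1 : v <> r t by move=> e; apply: (o_ne v); rewrite ov -e.
have v_ne3 : v <> r (r (r t)).
  by move=> e; apply: (r_ne u); rewrite -ot -[t in o t]rot4 -e -ou oppK.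
have u_ne2 : u <> r (r t) by move=> e; apply: (red t); rewrite -e.
have v_ne2 : v <> r (r t) by move=> e; apply: (red t); rewrite -e Ftu.
have uN : u \notin porbit r t.
  by rewrite mem_crossing !inE eq_sym (negPf ne_tu); do !case: eqP => //.
have vN : v \notin porbit r t.
  by rewrite mem_crossing !inE eq_sym (negPf ne_tv); do !case: eqP => //.
have /codomP[a uE] : u \in codom (smooth_dart (s := s)) by rewrite smooth_codom.
have /codomP[b vE] : v \in codom (smooth_dart (s := s)) by rewrite smooth_codom.
have not_merged : ~ smooth_merged t u.
  case=> /esym/Tmem[]/esym // e; first exact: (r_ne t).
  by apply: (r_ne t); rewrite {1}e rot4.
have tN p : smooth_dart (s := s) p <> t.
  move=> e; have := smooth_codom s t; rewrite -{1}e codom_f.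
  by rewrite porbit_id.
have ne_ab : a != b by apply: contraNneq ne_uv => e; rewrite uE vE e.
have -> : smooth_dart (s := s) @^-1: [set t; u; v] = [set a; b].
  apply/setP=> p; rewrite !inE uE vE !(inj_eq (smooth_inj (s := s))).
  by case: eqP => // /tN.
have Fab : porbit (face (smooth_proj s)) a = porbit (face (smooth_proj s)) b.
  by apply/(smooth_face (s := s)); left; rewrite -uE -vE.
have Qmem p : porbit (face (smooth_proj s)) p = porbit (face (smooth_proj s)) a ->
    p = a \/ p = b.
  move/(smooth_face (s := s)); rewrite -uE => -[/Tmem[/tN//|e|e] | [_ /not_merged//]].
    by left; apply: (smooth_inj (s := s)); rewrite -uE.
  by right; apply: (smooth_inj (s := s)); rewrite -vE.
have fix1 (p p' : dart (smooth_proj s)) : face _ p = p ->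
    porbit (face (smooth_proj s)) p' = porbit (face (smooth_proj s)) p -> p' = p.
  move=> fp e; apply/eqP; rewrite -[_ == _]in_set1; apply: face_closed e.
    by move=> z; rewrite !inE => /eqP->; rewrite fp.
  by rewrite inE.
apply: erase_bigon => //.
- by have := smooth_crossings s; lia.
- case: (Qmem (face _ a)) => //; first exact: face_step.
  by move/fix1/(_ (esym Fab))=> e; rewrite e eqxx in ne_ab.
- case: (Qmem (face _ b)) => //; first by rewrite face_step.
  by move/fix1/(_ Fab)=> e; rewrite e eqxx in ne_ab.
- apply/eqP=> e; apply: (red u).
  by rewrite Fuv vE e !smooth_rot -uE.
(* The regions across the three sides are those of [r t], [r u] and [r v]. Any two of them occupy
   opposite corners at a crossing of the triangle, hence differ. *)
move/(smooth_face (s := s)); rewrite !smooth_rot -uE => -[|[_ []]] e.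
- exact: (red (r u)).
- by apply: (red (r v)); rewrite -(face_oppE v) ov -e -(face_oppE u) ou.
- by apply: (red (r u)); rewrite e -(face_oppE t) ot.
Qed.

Lemma exists_erasable (P : connected_projection) : 3 < #|crossings P| ->
  exists (T : {set dart P}) (k : nat), 0 < k <= 3 /\ erasable T k.
Proof.
move=> V4; case: (pickP [pred y : dart P | F y == F (r (r y))]) => [x /eqP Fx | red0].
  by exists (porbit r x), 1%N; split=> //; apply: erase_reducible => //; lia.
have red (y : dart P) : F y <> F (r (r y)) by apply/eqP; rewrite [_ == _]red0.
have [t] := exists_small_face P.
have := uniq_traject_porbit f t; have := iter_porbit f t.
have: #|F t| != 0 by apply: card_porbit_neq0.
case: #|F t| => [|[|[|[|k]]]] //= _ => [ft | fft | ffft].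
- by exists [set t], 1%N; split=> //; apply: erase_monogon => //; lia.
- rewrite inE andbT => ne_tf _; exists [set t; f t], 2; split=> //.
  apply: erase_bigon => //; [lia | ].
  by apply/eqP=> e; apply: (red t); rewrite -e face_step.
- move=> ut _; exists [set t; f t; f (f t)], 3; split=> //.
  exact: erase_trigon.
Qed.

(** Above [n + 2] crossings at most three disappear at a time, so the descent cannot skip the range
    from [n] to [n + 2]. *)
Lemma independent_corners_from_small (n m : nat) :
    0 < n ->
    (forall Q : connected_projection, #|crossings Q| \in [:: n; n + 1; n + 2] ->
      exists2 S : {set dart Q}, independent_corners S & m <= #|S|) ->
  forall P : connected_projection, n <= #|crossings P| ->
    exists2 S : {set dart P}, independent_corners S & m <= #|S|.
Proof.
move=> n_gt0 small P; have [N] := ubnP #|crossings P|.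
elim: N => // N IHN in P * => ltPN le_nP.
have [leP|gtP] := leqP #|crossings P| (n + 2).
  by apply: small; rewrite !inE; lia.
have [|T [k [k3 [Q [VQ ext]]]]] := @exists_erasable P; first by lia.
have [|| S indS mS] := IHN Q; [lia | lia |].
by have [S' [indS' cardS' _]] := ext S indS; exists S'; rewrite ?cardS'.
Qed.

(** * Choice of one corner in each region *)

Section RegionsCorners.

Variable P : connected_projection.

Lemma independent_regions_corners m : has_independent_regions P m ->
  exists2 S : {set dart P}, independent_corners S & m <= #|S|.
Proof.
case=> S [sub_S indS mS].
case: (pickP (mem S)) => [R0 /(subsetP sub_S)/imsetP[x0 _ _] | S0]; last first.
  exists set0; first by move=> y z u v; rewrite inE.
  by rewrite cards0 -(eq_card0 S0).
pose g (R : {set dart P}) := odflt x0 [pick x in R].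
have gS R : R \in S -> F (g R) = R.
  move/(subsetP sub_S)/imsetP=> [x _ ->]; rewrite /g.
  by case: pickP => [y /porbit_eqP | /(_ x)]; rewrite ?porbit_id.
have inj_g : {in S &, injective g}.
  by move=> R1 R2 S1 S2 e; rewrite -(gS _ S1) e gS.
exists (g @: S); last by rewrite card_in_imset.
move=> y z u v /imsetP[R1 S1 ->{y}] /imsetP[R2 S2 ->{z}] ne_g.
rewrite !gS // => Fu Fv ruv; have ne_R : R1 != R2.
  by apply: contraNneq ne_g => ->.
have /negP := indS _ _ S1 S2 ne_R (porbit r u) (imset_f _ isT).
apply; apply/andP; split; apply/set0Pn.
  by exists u; rewrite inE -Fu !porbit_id.
by exists v; rewrite inE -Fv ruv !porbit_id.
Qed.

End RegionsCorners.

(** * Warping crossings of alternating diagrams *)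

Lemma find_lt_index (T : eqType) (x0 : T) (a : pred T) (s : seq T) y :
  has a s -> a y -> y != nth x0 s (find a s) -> find a s < index y s.
Proof.
move=> has_a ay ne_y; rewrite ltn_neqAle; apply/andP; split.
  apply: contraNneq ne_y => e; rewrite e nth_index //.
  by rewrite -index_mem -e -has_find.
rewrite leqNgt; apply/negP=> lt_y.
have ys : y \in s by rewrite -index_mem (ltn_trans lt_y) // -has_find.
by have := before_find x0 lt_y; rewrite nth_index // ay.
Qed.

Section WarpingCrossings.

Variables (P : connected_projection) (over : {ffun dart P -> bool}) (b : dart P).
Hypothesis knotP : is_knot P.
Hypothesis reducedP : forall y : dart P, F y <> F (r (r y)).
Hypothesis over_crossing : crossing_info over.
Hypothesis over_alternating : alternating over.
Implicit Types y z t : dart P.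

Local Notation s := (passages b).
Local Notation N := #|porbit (travel P) b|.

Let size_s : size s = N.
Proof. by rewrite size_traject. Qed.

Let nth_s k : k < N -> nth b s k = iter k.+1 (travel P) b.
Proof.
move=> ltk; rewrite (set_nth_default (travel P b)) ?size_s //.
by rewrite nth_traject // -iterSr.
Qed.

Let uniq_s : uniq s.
Proof. by rewrite /passages -porbit_step uniq_traject_porbit. Qed.

Let mem_s z : (z \in s) = (z \in porbit (travel P) b).
Proof. by rewrite /passages -[in LHS]porbit_step -porbit_traject porbit_step. Qed.

Let travelE z : travel P z = r (r (o z)).
Proof. by rewrite !permM. Qed.

(* The first time at which the branch through the darts [z] and [r (r z)] is
   traversed from the base point. *)
Let tau z := minn (index z s) (index (r (r z)) s).

Let tau_rr z : tau (r (r z)) = tau z.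
Proof. by rewrite /tau rot4 minnC. Qed.

(** A knot traverses each edge in some direction: the walk contains [z], or else [o z] and with it
    [travel (o z)], which is [r (r z)]. *)
Let tau_lt z : tau z < N.
Proof.
rewrite -size_s gtn_min !index_mem !mem_s; case/orP: (knotP b z) => [->//|].
by rewrite -!eq_porbit_mem -(porbit_step _ (o z)) travelE oppK => ->; rewrite orbT.
Qed.

Let tau_eq y z : tau y = tau z -> y = z \/ y = r (r z).
Proof.
have nth_tau u : nth b s (tau u) = u \/ nth b s (tau u) = r (r u).
  have := tau_lt u; rewrite /tau -size_s.
  case: (leqP (index u s)) => _ lt_u.
    by left; rewrite nth_index // -index_mem.
  by right; rewrite nth_index // -index_mem.
move=> e; have := nth_tau z; rewrite -e; case: (nth_tau y) => -> [e'|e']; auto.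
  by right; rewrite -e' rot4.
by left; do 2!apply: (@perm_inj _ (Defs.rot P)).
Qed.

(** The ends of an edge without the base point are passed in immediate succession: after leaving
    through [z] the walk next leaves through [r (r (o z))], and before leaving through [r (r z)] it
    left through [o z]. *)
Let tau_edge z : z != b -> o z != b -> tau (o z) <= (tau z).+1.
Proof.
move=> ne_zb ne_ozb; have := tau_lt z; rewrite /tau.
case: (leqP (index z s)) => _ lt_z.
  set k := index z s in lt_z *.
  have zE : iter k.+1 (travel P) b = z.
    by rewrite -nth_s // nth_index // -index_mem size_s.
  (* The walk is back at [b] after [N] steps, so [z != b] leaves room for one more passage. *)
  have lt_k1 : k.+1 < N.
    rewrite ltn_neqAle lt_z andbT; apply: contraNneq ne_zb => e.
    by rewrite -zE e iter_porbit.
  have <- : index (r (r (o z))) s = k.+1.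
    rewrite -(index_uniq b _ uniq_s (i := k.+1)) ?size_s //.
    by rewrite nth_s // iterS zE travelE.
  exact: geq_minr.
(* Position 0 would mean that the walk came directly from the base point, that is, [o z = b]. *)
case def_k: (index (r (r z)) s) lt_z => [|k] lt_z.
  have := nth_s lt_z; rewrite -def_k nth_index ?def_k; last first.
    by rewrite -index_mem def_k size_s.
  rewrite /= travelE => /perm_inj/perm_inj e.
  by rewrite e oppK eqxx in ne_ozb.
have ozE : iter k.+1 (travel P) b = o z.
  apply: (@perm_inj _ (travel P)); rewrite -iterS -nth_s // -def_k nth_index.
    by rewrite travelE oppK.
  by rewrite -index_mem def_k size_s.
have -> : index (o z) s = k.
  rewrite -(index_uniq b _ uniq_s (i := k)) ?size_s ?(ltnW lt_z) //.
  by rewrite nth_s ?(ltnW lt_z) // ozE.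
by rewrite geq_min -addn2 leq_addr.
Qed.

Let over_r z : over (r z) = ~~ over z.
Proof. by have /forallP/(_ z)/andP[_ /eqP] := over_crossing. Qed.

(** Height changes from one end of an edge to the other and again between the two branches of a
    crossing; a step of [face] makes both changes. *)
Let over_face z : over (f z) = over z.
Proof.
have /forallP/(_ z)/eqP := over_alternating; rewrite travelE -rot_face.
by rewrite !over_r !negbK => /negb_inj.
Qed.

(** The first passage is above, hence on the branch of [z], and the branch of [r z] comes later. *)
Let tau_nonwarping z :
  over (first_passage b (porbit r z)) -> over z -> tau z < tau (r z).
Proof.
rewrite /first_passage; set c := porbit r z => over_p over_z.
have cE y : y \in c -> [\/ y = z, y = r z, y = r (r z) | y = r (r (r z))].
  rewrite mem_crossing !inE => /or4P[]/eqP->;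
  by [constructor 1|constructor 2|constructor 3|constructor 4].
have zc : [/\ z \in c, r z \in c, r (r z) \in c & r (r (r z)) \in c].
  by split; rewrite mem_crossing !inE eqxx ?orbT.
have has_c : has (mem c) s.
  have := tau_lt z; rewrite gtn_min -size_s !index_mem => /orP[zs|zs];
  apply/hasP; [exists z | exists (r (r z))] => //; by case: zc.
have := nth_find b has_c; move: over_p; set p := nth b s _ => over_p pc.
have index_p : index p s = find (mem c) s by rewrite index_uniq // -has_find.
have ne_p y : over y = ~~ over z -> y != p.
  by move=> over_y; apply/eqP=> e; rewrite -e over_y over_z in over_p.
have [_ zc1 _ zc3] := zc.
have le_tau : tau z <= find (mem c) s.
  have over_p2 : p = z \/ p = r (r z).
    by case: (cE p pc) over_p => ->; rewrite ?over_r ?over_z; auto.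
  by rewrite -index_p /tau geq_min; case: over_p2 => ->; rewrite leqnn ?orbT.
by rewrite [tau (r z)]/tau leq_min !(leq_ltn_trans le_tau) //;
  apply: (find_lt_index has_c) => //; apply: ne_p; rewrite !over_r ?negbK.
Qed.

(* Otherwise [tau] on the over-strands is monotone around the region, hence
   constant, so that two successive corners lie on the same branch. *)
Lemma region_warping_crossing t :
    b \notin F t -> o b \notin F t ->
  exists2 z, z \in F t & porbit r z \in warping_crossings over b.
Proof.
move=> bN obN.
case: (pickP [pred z in F t | porbit r z \in warping_crossings over b]) => [z /andP[] | no_w].
  by exists z.
have over_first z : z \in F t -> over (first_passage b (porbit r z)).
  move=> zT; have := no_w z; rewrite /= zT inE imset_f //=.
  by move/negbFE.
have fT z : z \in F t -> f z \in F t by rewrite -!eq_porbit_mem porbit_step.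
have overT z : z \in F t -> over z = over t.
  by move/porbit_eqP; apply: porbit_fun_eq.
have edge z : z \in F t -> z != b /\ o z != b.
  move=> zT; split; apply/eqP=> e; first by rewrite -e zT in bN.
  by rewrite -e oppK zT in obN.
(* Equal times would force one of these equalities, and each makes the crossing of [t] reducible. *)
have ft_neq : f t <> t /\ f t <> r (r t).
  split=> e; last by apply: (reducedP (y := t)); rewrite -e porbit_step.
  by apply: (reducedP (y := r t)); rewrite -face_oppE -rot_face e.
have [over_t | under_t] := boolP (over t).
  have tau_f z : z \in F t -> tau (f z) <= tau z.
    move=> zT; have [ne1 ne2] := edge z zT; rewrite -ltnS.
    apply: leq_trans (tau_edge ne1 ne2); rewrite -rot_face.
    by apply: tau_nonwarping; rewrite ?over_first ?fT // overT ?fT.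
  have := porbit_homo_const tau_f erefl (porbit_id _ t).
  by case/tau_eq; case: ft_neq.
(* Now the over-strands are those of the darts [r z], and their times do not decrease around the
   region; subtracting from [N] reverses the order. *)
have tau_f z : z \in F t -> N - tau (r (f z)) <= N - tau (r z).
  move=> zT; have [ne1 ne2] := edge z zT; apply: leq_sub2l.
  rewrite rot_face -ltnS; apply: (@leq_trans (tau z)); last first.
    by rewrite -{1}[z]oppK tau_edge // oppK.
  rewrite -[tau z]tau_rr; apply: tau_nonwarping.
    by rewrite porbit_step over_first.
  by rewrite over_r overT.
have := porbit_homo_const tau_f erefl (porbit_id _ t).
have := tau_lt (r t); have := tau_lt (r (f t)) => lt1 lt2 e.
have /tau_eq : tau (r (f t)) = tau (r t) by lia.
by case=> /perm_inj; case: ft_neq.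
Qed.

Lemma warping_crossings_geq (S : {set dart P}) :
  independent_corners S -> #|S| - 1 <= #|warping_crossings over b|.
Proof.
move=> indS; set W := warping_crossings over b.
(* At most one region is dropped, as two on the base edge would share a crossing. *)
pose S' := [set t in S | (b \notin F t) && (o b \notin F t)].
have leS : #|S| - 1 <= #|S'|.
  rewrite leq_subLR addnC -(cardsID S' S) leq_add //.
    by rewrite subset_leq_card // subsetIr.
  apply/card_le1_eqP=> y z; rewrite !inE !negb_and !negbK.
  move=> /andP[yN yS] /andP[zN zS]; rewrite yS in yN; rewrite zS in zN.
  case/orP: yN => // /orP[]/porbit_eqP Fy; case/orP: zN => // /orP[]/porbit_eqP Fz.
  - by apply: (independent_corners_inj indS); rewrite // -Fy.
  - exact/esym/(independent_corners_edge indS yS zS Fy Fz).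
  - exact: (independent_corners_edge indS zS yS Fz Fy).
  - by apply: (independent_corners_inj indS); rewrite // -Fy.
apply: leq_trans leS _.
pose g t := porbit r (odflt t [pick z in F t | porbit r z \in W]).
have gP t : t \in S' -> g t \in W /\ exists2 z, F z = F t & g t = porbit r z.
  rewrite inE => /and3P[_ bN obN]; rewrite /g.
  have [z zT zW] := region_warping_crossing bN obN.
  case: pickP => [y /andP[/porbit_eqP yT yW] | /(_ z)]; last by rewrite zT zW.
  by split=> //; exists y.
have inj_g : {in S' &, injective g}.
  move=> y z yS zS e; have [_ [u Fu gu]] := gP y yS; have [_ [v Fv gv]] := gP z zS.
  apply/eqP; apply: contraT => ne_yz; move: yS zS; rewrite !inE => /andP[yS _] /andP[zS _].
  by case: (indS y z u v yS zS ne_yz Fu Fv); rewrite -gu -gv.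
rewrite -(card_in_imset inj_g); apply/subset_leq_card/subsetP=> _ /imsetP[t tS ->].
by case: (gP t tS).
Qed.

End WarpingCrossings.

(** * The bound on the warping degree *)

Lemma warping_degree_geq (P : connected_projection) (S : {set dart P}) :
  is_knot P -> reduced P -> independent_corners S -> #|S| - 1 <= warping_degree P.
Proof.
move=> knotP redP indS.
have red (y : dart P) : F y <> F (r (r y)).
  move=> e; apply: (redP (porbit r y)); first exact: imset_f.
  exists (F y); first exact: imset_f.
  by exists y; rewrite ?porbit_id //=; apply/porbit_eqP.
(* The neutral element of the minima must satisfy the bound too; it does, since independent corners
   lie at distinct crossings. *)
have le_crossings : #|S| - 1 <= #|crossings P|.
  apply: leq_trans (leq_subr _ _) _.
  have inj_S : {in S &, injective (porbit r)}.
    move=> y z yS zS e; apply/eqP; apply: contraT => ne_yz.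
    by case: (indS y z y z yS zS ne_yz erefl erefl).
  rewrite -(card_in_imset inj_S); apply/subset_leq_card/subsetP=> _ /imsetP[y _ ->].
  exact: imset_f.
have min_geq (I : finType) (A : pred I) (h : I -> nat) :
    (forall i, A i -> #|S| - 1 <= h i) ->
    #|S| - 1 <= \big[minn/#|crossings P|]_(i | A i) h i.
  move=> geq_h; apply: (big_ind (fun k => #|S| - 1 <= k)) => // k1 k2 ge1 ge2.
  by rewrite leq_min ge1.
apply: (min_geq) => R _; apply: (min_geq) => over /andP[crossing_over alt_over].
by apply: min_geq => b _; apply: warping_crossings_geq.
Qed.

Theorem theorem1p2 (n m : nat) (n_gt0 : 0 < n) (m_gt0 : 0 < m)
  (small_projections : forall Q : connected_projection,
     #|crossings Q| \in [:: n; n + 1; n + 2] -> has_independent_regions Q m) :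
  forall P : connected_projection,
    is_knot P -> reduced P -> n <= #|crossings P| ->
    m - 1 <= warping_degree P.
Proof.
move=> P knotP redP le_n.
have small Q : #|crossings Q| \in [:: n; n + 1; n + 2] ->
    exists2 S : {set dart Q}, independent_corners S & m <= #|S|.
  by move/small_projections; apply: independent_regions_corners.
have [S indS mS] := independent_corners_from_small n_gt0 small le_n.
by apply: leq_trans (warping_degree_geq knotP redP indS); apply: leq_sub2r.
Qed.
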